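(* For any prime $p$, \[ \{(r,e,d)\in\mathscr{A}(p)\mid r=2\ \text{or}\ r\nmid p-1\}=\{(r,e,d)\in\mathscr{B}(p)\mid r=2\ \text{or}\ r\nmid p-1\}. \]
   Context: Let $p$ be a prime. For an integer $r\ge 2$ let $x_1,\ldots,x_r$ be independent indeterminates over $\mathbb{F}_p$ and $f(x)=(x-x_1)\cdots(x-x_r)\in\mathbb{F}_p[x_1,\ldots,x_r][x]$. For integers $e\ge 0$ and $0\le d\le p$ write $f(x)^e=\sum_{i\ge0}c_ix^i$ (with $c_i=0$ for $i<0$) and let $M_d(f(x)^e)$ be the $d\times d$ matrix whose $(i,j)$ entry is $c_{ip+j-d-1}$. Put $\delta(x_1,\ldots,x_r)=\prod_{1\le i<j\le r}(x_i-x_j)$. $\mathscr{A}(p)$ is the set of integer triples $(r,e,d)$ with $r\ge2$, $e\ge1$, $1\le d\le p$, such that $\det M_d(f(x)^e)=\varepsilon\,\delta(x_1,\ldots,x_r)^g$ for some $\varepsilon\in\mathbb{F}_p^{\times}$ and some positive integer $g$. $\mathscr{B}(p)=\mathscr{B}_+(p)\cup\mathscr{B}_0(p)\cup\mathscr{B}_-(p)$ where $\mathscr{B}_+(p)=\{(r,e,d): 2\le r\le p,\ e=p-1,\ d=r\}$, $\mathscr{B}_0(p)=\{(r,e,d): 2\le r\le p+1,\ (p-1)/2<e\le p-1,\ r(p-1-e)\le p-1,\ d=r-1\}$, $\mathscr{B}_-(p)=\{(r,e,d): r\ge2,\ (p-1)/2<e\le p-1,\ r(p-1-e)=p-1,\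 d=r-2\}$ (integer triples). $r\nmid p-1$ means $r$ does not divide $p-1$. *)

(* Defs.v *)
From HB Require Import structures.
From mathcomp Require Import all_boot all_order all_algebra.
From mathcomp Require Import mpoly.
Set Implicit Arguments. Unset Strict Implicit. Unset Printing Implicit Defensive.
Import GRing.Theory.
Local Open Scope ring_scope.

Definition fpoly (p r : nat) : {poly {mpoly 'F_p[r]}} :=
  \prod_(i < r) ('X - ('X_i)%:P).

(* M_d(f^e): (i,j) entry (1-based) is c_{ip+j-d-1}, with c_k = 0 for k<0.
   With 0-based i,j : 'I_d the index is (i+1)p + j - d. *)
Definition Mmat (p r e d : nat) : 'M[{mpoly 'F_p[r]}]_d :=
  \matrix_(i < d, j < d)
    (if (d <= i.+1 * p + j)%N then (fpoly p r ^+ e)`_(i.+1 * p + j - d)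
     else 0).

Definition vdelta (p r : nat) : {mpoly 'F_p[r]} :=
  \prod_(i < r) \prod_(j < r | (i < j)%N) ('X_i - 'X_j).

Definition inA (p r e d : nat) : Prop :=
  [/\ (2 <= r)%N, (1 <= e)%N, (1 <= d <= p)%N &
    exists (eps : 'F_p) (g : nat), [/\ eps != 0, (0 < g)%N &
      \det (Mmat p r e d) = eps%:MP * vdelta p r ^+ g]].

Definition inBplus (p r e d : nat) : Prop :=
  [/\ (2 <= r <= p)%N, e = p.-1 & d = r].
(* (p-1)/2 < e is encoded as p-1 < 2e; p-1-e is nonnegative since e <= p-1 *)
Definition inB0 (p r e d : nat) : Prop :=
  [/\ (2 <= r <= p.+1)%N, (p.-1 < 2 * e)%N, (e <= p.-1)%N,
      (r * (p.-1 - e) <= p.-1)%N & d = r.-1].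
Definition inBminus (p r e d : nat) : Prop :=
  [/\ (2 <= r)%N, (p.-1 < 2 * e)%N, (e <= p.-1)%N,
      (r * (p.-1 - e) = p.-1)%N & d = r.-2].
Definition inB (p r e d : nat) : Prop :=
  inBplus p r e d \/ inB0 p r e d \/ inBminus p r e d.

(* Main.v *)
(* Up to column order, M_d(w) is the matrix of h |-> C(w h) on polynomials of
   degree < d, where C keeps the coefficients of x^(p-1), x^(2p-1), ...; C kills
   derivatives.

   From B to A. For e = p-1 and g_k = f / (x - x_k), f^(p-1) g_k equals
   g_k^p (x - x_k)^(p-1), so M_r maps the basis g_k to its Frobenius twist and
   det M_r = delta^(p-1) up to a unit; deleting a trivial row and column gives
   d = r-1. Reducing f h modulo the polynomials f u' + (e+1) f' u (whose product
   with f^e is a derivative) writes M_(r-1)(f^(e+1)) = M_(r-1)(f^e) T, where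
   det T is the resultant of f and f', i.e. delta^2, up to a unit as long as
   r(p-1-e) < p; descend from e = p-1.

   From A to B. Specialize the x_i. Setting x_1 = 0 gives e < p; the last row is
   nonzero, so d(p-1) <= re; homogeneity and the degree in x_1 relate g to
   (r, e, d). This leaves d <= r-2. If p does not divide r, take for the x_i the
   r-th roots of unity: f^e is a polynomial in x^r, so det M_d <> 0 yields a
   permutation of {1..d} which is multiplication by p modulo r, and then p = 1
   modulo r. If p divides r, the degree relations are contradictory. *)
Require Import Defs.
From mathcomp Require Import all_boot all_order all_algebra.
From mathcomp Require Import all_fingroup all_field zify ring.
From mathcomp Require Import mpoly.
Set Implicit Arguments. Unset Strict Implicit. Unset Printing Implicit Defensive.
Import GRing.Theory.
Local Open Scope ring_scope.

(** * The matrix of the Cartier operator *)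

Definition rootpoly (R : nzRingType) r (x : 'I_r -> R) : {poly R} :=
  \prod_(i < r) ('X - (x i)%:P).

Definition vandermonde_prod (R : nzRingType) r (x : 'I_r -> R) : R :=
  \prod_(i < r) \prod_(j < r | (i < j)%N) (x i - x j).

(** For d <= p these are the columns of M_d in reverse order, so that column [j] belongs to the
    monomial X^j. The ring is arbitrary because the roots get specialized later. *)
Definition cartier_mx (R : nzRingType) p (w : {poly R}) d : 'M[R]_d :=
  \matrix_(i, j) ('X^j * w)`_(i.+1 * p).-1.

Lemma Mmat_cartier (p r e d : nat) : (d <= p)%N ->
  exists b : bool, \det (Mmat p r e d) =
    (-1) ^+ b * \det (cartier_mx p (rootpoly (fun i : 'I_r => 'X_i : {mpoly 'F_p[r]}) ^+ e) d).
Proof.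
move=> led; pose s := perm (@rev_ord_inj d); exists s.
suff -> : Mmat p r e d =
    col_perm s (cartier_mx p (rootpoly (fun i : 'I_r => 'X_i : {mpoly 'F_p[r]}) ^+ e) d).
  by rewrite col_permE det_mulmx det_perm mulrC odd_permV.
apply/matrixP=> i j; rewrite !mxE permE coefXnM /=.
have jd := ltn_ord j; have id := ltn_ord i.
have hp : (p <= i.+1 * p)%N by rewrite leq_pmull.
case: leqP => h1; case: ltnP => h2 //; first by lia.
- by congr (_`_ _); lia.
- by lia.
Qed.

(** * Determinants built from linear functionals *)

Lemma functional_mx (R : comNzRingType) m n N (lam : 'I_m -> {poly R} -> R)
    (w : 'I_n -> {poly R}) :
    (forall i, scalar (lam i)) -> (forall j, (size (w j) <= N)%N) ->
  (\matrix_(i < m, k < N) lam i 'X^k) *m (\matrix_(k < N, j < n) (w j)`_k)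
  = \matrix_(i, j) lam i (w j).
Proof.
move=> lamP szw; apply/matrixP=> i j; rewrite !mxE.
have -> : w j = \sum_(k < N) (w j)`_k *: 'X^k.
  rewrite -[LHS]coefK poly_def (big_ord_widen _ (fun k => (w j)`_k *: 'X^k) (szw j)).
  rewrite big_mkcond /=; apply: eq_bigr => k _; case: ltnP => // h.
  by rewrite nth_default // scale0r.
have lam0 : lam i 0 = 0.
  by have := lamP i (-1) 0 0; rewrite scaler0 addr0 mulN1r addNr.
have lamD a u v : lam i (a *: u + v) = a * lam i u + lam i v by exact: lamP.
have -> : lam i (\sum_(k < N) (w j)`_k *: 'X^k) = \sum_(k < N) (w j)`_k * lam i 'X^k.
  elim/big_rec2: _ => [|k y1 y2 _ IH]; first exact: lam0.
  by rewrite lamD IH.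
by apply: eq_bigr => k _; rewrite !mxE mulrC.
Qed.

(* The families (a, c) and (b, c) are compared through the functionals (D, Z)
   and (H, E): D kills c and E kills b, so three of the four evaluation
   matrices are block triangular. *)
Lemma det_functional_cross (R : comNzRingType) s t (D H : 'I_s -> {poly R} -> R)
    (Z E : 'I_t -> {poly R} -> R) (a b : 'I_s -> {poly R}) (c : 'I_t -> {poly R}) :
    [/\ forall i, scalar (D i), forall i, scalar (H i), forall i, scalar (Z i)
      & forall i, scalar (E i)] ->
    [/\ forall j, (size (a j) <= s + t)%N, forall j, (size (b j) <= s + t)%N
      & forall j, (size (c j) <= s + t)%N] ->
    (forall i j, D i (c j) = 0) -> (forall i j, E i (b j) = 0) ->
  \det (\matrix_(i, j) D i (a j)) * \det (\matrix_(i, j) Z i (c j)) *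
    (\det (\matrix_(i, j) H i (b j)) * \det (\matrix_(i, j) E i (c j))) =
  \det (\matrix_(i, j) D i (b j)) * \det (\matrix_(i, j) Z i (c j)) *
    (\det (col_mx (\matrix_(i < s, k < s + t) H i 'X^k)
                 (\matrix_(i < t, k < s + t) E i 'X^k)) *
     \det (row_mx (\matrix_(k < s + t, j < s) (a j)`_k)
                 (\matrix_(k < s + t, j < t) (c j)`_k))).
Proof.
move=> [lD lH lZ lE] [sa sb sc] Dc Eb.
have blk (F : 'I_s -> {poly R} -> R) (G : 'I_t -> {poly R} -> R) (u : 'I_s -> {poly R}) :
    (forall i, scalar (F i)) -> (forall i, scalar (G i)) ->
    (forall j, (size (u j) <= s + t)%N) ->
    \det (col_mx (\matrix_(i < s, k < s + t) F i 'X^k)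
                 (\matrix_(i < t, k < s + t) G i 'X^k)) *
    \det (row_mx (\matrix_(k < s + t, j < s) (u j)`_k)
                 (\matrix_(k < s + t, j < t) (c j)`_k)) =
    \det (block_mx (\matrix_(i, j) F i (u j)) (\matrix_(i, j) F i (c j))
                   (\matrix_(i, j) G i (u j)) (\matrix_(i, j) G i (c j))).
  by move=> lF lG su; rewrite -det_mulmx mul_col_row !functional_mx.
have D0 : \matrix_(i, j) D i (c j) = 0 by apply/matrixP=> i j; rewrite !mxE.
have E0 : \matrix_(i, j) E i (b j) = 0 by apply/matrixP=> i j; rewrite !mxE.
have -> : \det (\matrix_(i, j) D i (a j)) * \det (\matrix_(i, j) Z i (c j)) =
    \det (block_mx (\matrix_(i, j) D i (a j)) (\matrix_(i, j) D i (c j))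
                   (\matrix_(i, j) Z i (a j)) (\matrix_(i, j) Z i (c j))).
  by rewrite D0 det_lblock.
have -> : \det (\matrix_(i, j) D i (b j)) * \det (\matrix_(i, j) Z i (c j)) =
    \det (block_mx (\matrix_(i, j) D i (b j)) (\matrix_(i, j) D i (c j))
                   (\matrix_(i, j) Z i (b j)) (\matrix_(i, j) Z i (c j))).
  by rewrite D0 det_lblock.
have -> : \det (\matrix_(i, j) H i (b j)) * \det (\matrix_(i, j) E i (c j)) =
    \det (block_mx (\matrix_(i, j) H i (b j)) (\matrix_(i, j) H i (c j))
                   (\matrix_(i, j) E i (b j)) (\matrix_(i, j) E i (c j))).
  by rewrite E0 det_ublock.
(* Each block determinant is a functional determinant times a coefficient determinant; both sides
   then consist of the same four factors. *)
rewrite -!blk //; ring.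
Qed.

(** * Polynomials with prescribed roots *)

Section RootPoly.
Variables (R : comNzRingType) (r : nat) (x : 'I_r -> R).

Lemma rootpoly_monic : rootpoly x \is monic.
Proof. exact: monic_prod_XsubC. Qed.

Lemma size_rootpoly : size (rootpoly x) = r.+1.
Proof. by rewrite /rootpoly -big_enum size_prod_XsubC size_enum_ord. Qed.

Lemma size_rootpolyX e : size (rootpoly x ^+ e) = (r * e).+1.
Proof.
elim: e => [|e IH]; first by rewrite expr0 size_poly1 muln0.
rewrite exprS size_monicM ?rootpoly_monic ?monic_neq0 ?monic_exp ?rootpoly_monic //.
by rewrite IH size_rootpoly; lia.
Qed.

Lemma horner_rootpoly i : (rootpoly x).[x i] = 0.
Proof.
by rewrite horner_prod (bigD1 i) //= hornerXsubC subrr mul0r.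
Qed.

Definition corootpoly k : {poly R} := \prod_(i < r | i != k) ('X - (x i)%:P).

Lemma rootpolyD1 k : rootpoly x = ('X - (x k)%:P) * corootpoly k.
Proof. by rewrite /rootpoly (bigD1 k). Qed.

Lemma size_corootpoly k : size (corootpoly k) = r.
Proof.
have := size_rootpoly; rewrite (rootpolyD1 k) size_monicM ?monicXsubC //.
  by rewrite size_XsubC => -[].
by rewrite monic_neq0 // monic_prod_XsubC.
Qed.

Lemma horner_corootpoly k j : j != k -> (corootpoly k).[x j] = 0.
Proof.
by move=> h; rewrite horner_prod (bigD1 j) //= hornerXsubC subrr mul0r.
Qed.

Lemma horner_deriv_rootpoly i : (rootpoly x)^`().[x i] = (corootpoly i).[x i].
Proof.
by rewrite (rootpolyD1 i) derivM derivXsubC !hornerE subrr mul0r addr0.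
Qed.

Lemma det_Vandermonde_tr :
  exists b : bool, \det (\matrix_(i < r, k < r) x i ^+ k) = (-1) ^+ b * vandermonde_prod x.
Proof.
have -> : \matrix_(i < r, k < r) x i ^+ k = (Vandermonde r (\row_i x i))^T.
  by apply/matrixP=> i j; rewrite !mxE.
rewrite det_tr det_Vandermonde /vandermonde_prod.
pose K := (\sum_(i < r) \sum_(j < r | (i < j)%N) 1)%N.
exists (odd K); rewrite signr_odd /K -prodrXr -big_split /=.
apply: eq_bigr => i _; rewrite -prodrXr -big_split /=; apply: eq_bigr => j _.
by rewrite !mxE expr1 mulN1r opprB.
Qed.

(** Up to sign this is the discriminant: the factors are the values f'(x_i), and each pair
    contributes (x_i - x_j)(x_j - x_i). *)
Lemma prod_horner_corootpoly : exists b : bool,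
  \prod_i (corootpoly i).[x i] = (-1) ^+ b * vandermonde_prod x ^+ 2.
Proof.
pose K := (\sum_(i < r) \sum_(j < r | (j < i)%N) 1)%N.
exists (odd K); rewrite signr_odd /K expr2 mulrA.
have -> : \prod_i (corootpoly i).[x i] =
   (\prod_(i < r) \prod_(j < r | (j < i)%N) (x i - x j)) * vandermonde_prod x.
  rewrite -big_split /=; apply: eq_bigr => i _.
  rewrite horner_prod (bigID (fun j : 'I_r => (j < i)%N)) /=; congr (_ * _).
    apply: eq_big => [j|j _]; last by rewrite hornerXsubC.
    by rewrite -val_eqE /=; case: ltngtP.
  apply: eq_big => [j|j _]; last by rewrite hornerXsubC.
  by rewrite -val_eqE /=; case: ltngtP.
congr (_ * _).
have -> : vandermonde_prod x = \prod_(i < r) \prod_(j < r | (j < i)%N) (x j - x i).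
  by rewrite /vandermonde_prod (exchange_big_dep predT).
rewrite -prodrXr -big_split /=.
apply: eq_bigr => i _; rewrite -prodrXr -big_split /=; apply: eq_bigr => j _.
by rewrite expr1 mulN1r opprB.
Qed.
End RootPoly.

Lemma det_high_eval_mx (R : comNzRingType) s (x : 'I_s.+1 -> R) : exists b : bool,
  \det (col_mx (\matrix_(i < s, k < s + s.+1) ('X^k : {poly R})`_(s.+1 + i))
               (\matrix_(i < s.+1, k < s + s.+1) ('X^k).[x i])) =
  (-1) ^+ b * \det (\matrix_(i < s.+1, k < s.+1) x i ^+ k).
Proof.
(* Bring the columns of degrees s+1, ..., 2s to the front: the coefficient rows become (1 | 0), and
   the Vandermonde matrix is the other diagonal block. *)
pose f (k : 'I_(s + s.+1)) : 'I_(s + s.+1) :=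
  match split k with
  | inl i => cast_ord (addnC _ _) (rshift s.+1 i)
  | inr i => cast_ord (addnC _ _) (lshift s i) end.
have finj : injective f.
  move=> i j; rewrite /f -{2}(splitK i) -{2}(splitK j).
  case: (split i) => a; case: (split j) => c /(congr1 val) /= h.
  - by congr (unsplit (inl _)); apply/val_inj/eqP; rewrite -(eqn_add2l s.+1); apply/eqP.
  - by have := ltn_ord c; rewrite -h; lia.
  - by have := ltn_ord a; rewrite h; lia.
  - by congr (unsplit (inr _)); apply/val_inj.
pose g := perm finj; exists g.
set M := col_mx _ _; set V := \matrix_(_, _) _.
suff h : \det (col_perm g M) = \det V.
  by rewrite -h col_permE det_mulmx det_perm odd_permV mulrCA -expr2 sqrr_sign mulr1.
have -> : col_perm g M = block_mx 1%:M 0 (\matrix_(i < s.+1, k < s) x i ^+ (s.+1 + k)) V.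
  apply/matrixP=> i j; rewrite mxE permE /f -(splitK i) -(splitK j).
  case: (split i) => a; case: (split j) => c; rewrite !unsplitK /= /M.
  - by rewrite col_mxEu block_mxEul !mxE coefXn /= eqn_add2l.
  - rewrite col_mxEu block_mxEur !mxE coefXn /=.
    by have := ltn_ord c; case: eqP => //; lia.
  - by rewrite col_mxEd block_mxEdl !mxE hornerXn.
  - by rewrite col_mxEd block_mxEdr !mxE hornerXn.
by rewrite det_lblock det1 mul1r.
Qed.

(** * Equality up to a nonzero scalar *)

Section FpAssoc.
Variables (p : nat) (R : idomainType) (h : {rmorphism 'F_p -> R}).

(** Constants come from F_p only, as the unit in the definition of A(p) does; [h] lets one relation
    serve polynomial rings and field extensions alike. *)
Definition fpassoc (a b : R) := exists2 c : 'F_p, c != 0 & a = h c * b.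

Lemma fpassoc_refl a : fpassoc a a.
Proof. by exists 1; rewrite ?oner_eq0 // rmorph1 mul1r. Qed.

Lemma fpassoc_sym a b : fpassoc a b -> fpassoc b a.
Proof.
move=> [c c0 ->]; exists c^-1; first by rewrite invr_eq0.
by rewrite mulrA -rmorphM mulVf // rmorph1 mul1r.
Qed.

Lemma fpassoc_trans b a c : fpassoc a b -> fpassoc b c -> fpassoc a c.
Proof.
move=> [u u0 ->] [v v0 ->]; exists (u * v); first by rewrite mulf_neq0.
by rewrite rmorphM mulrA.
Qed.

Lemma fpassocM a b c d : fpassoc a b -> fpassoc c d -> fpassoc (a * c) (b * d).
Proof.
move=> [u u0 ->] [v v0 ->]; exists (u * v); first by rewrite mulf_neq0.
by rewrite rmorphM; ring.
Qed.

Lemma fpassocX n a b : fpassoc a b -> fpassoc (a ^+ n) (b ^+ n).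
Proof.
by move=> ab; elim: n => [|n IH]; [exact: fpassoc_refl | rewrite !exprS; exact: fpassocM].
Qed.

Lemma fpassocMI d a b : d != 0 -> fpassoc (a * d) (b * d) -> fpassoc a b.
Proof. by move=> d0 [c c0]; rewrite mulrA => /(mulIf d0) ->; exists c. Qed.

Lemma fpassoc_sign n a : fpassoc ((-1) ^+ n * a) a.
Proof.
by exists ((-1) ^+ n); [rewrite expf_neq0 // oppr_eq0 oner_eq0 | rewrite rmorph_sign].
Qed.

Lemma fpassoc_nat n a : prime p -> ~~ (p %| n)%N -> fpassoc (n%:R * a) a.
Proof.
move=> pp pn; exists n%:R; last by rewrite rmorph_nat.
by rewrite -(dvdn_pcharf (pchar_Fp pp)).
Qed.

Lemma fpassoc_neq0 a b : fpassoc a b -> a != 0 -> b != 0.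
Proof. by move=> [c _ ->]; rewrite mulf_eq0 negb_or => /andP[]. Qed.

Lemma pchar_Fp_morph : prime p -> p \in [pchar R].
Proof. by move=> pp; rewrite (rmorph_pchar h) // pchar_Fp. Qed.

End FpAssoc.

(** * Frobenius and the coefficients kept by the Cartier operator *)

Lemma pchar_polyXE (p : nat) (R : comNzRingType) (q : {poly R}) : p \in [pchar R] ->
  q ^+ p = (\poly_(i < size q) q`_i ^+ p) \Po 'X^p.
Proof.
move=> pR; have pR' : p \in [pchar {poly R}] by rewrite pchar_poly.
rewrite -(pFrobenius_autE pR') -{1}(coefK q) !poly_def !rmorph_sum /=.
apply: eq_bigr => i _.
rewrite linearZ /= comp_Xn_poly -mul_polyC rmorphM /= !pFrobenius_autE.
by rewrite -polyC_exp mul_polyC -!exprM mulnC.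
Qed.

(** Since u has degree below p and q(X^p) only has exponents divisible by p, the exponent (i+1)p - 1
    arises only as (p-1) + ip. *)
Lemma coefM_comp_Xp (p : nat) (R : comNzRingType) (u q : {poly R}) i :
  (0 < p)%N -> (size u <= p)%N ->
  (u * (q \Po 'X^p))`_(i.+1 * p).-1 = u`_p.-1 * q`_i.
Proof.
move=> p0 su; rewrite coefM.
have hp : (p.-1 < (i.+1 * p).-1.+1)%N by rewrite mulSn; lia.
rewrite (bigD1 (Ordinal hp)) //= big1 ?addr0 => [|j].
  rewrite coef_comp_poly_Xn //.
  have -> : ((i.+1 * p).-1 - p.-1 = i * p)%N by nia.
  by rewrite dvdn_mull // mulnK.
rewrite -val_eqE /= => jp.
have [h|h] := leqP p j; first by rewrite nth_default ?mul0r // (leq_trans su).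
rewrite coef_comp_poly_Xn //.
have jl : (j < p.-1)%N by lia.
have -> : ((i.+1 * p).-1 - j = i * p + (p.-1 - j))%N by nia.
by rewrite dvdn_addr ?dvdn_mull // gtnNdvd ?mulr0 //; lia.
Qed.

Lemma coef_deriv_pchar (p : nat) (R : comNzRingType) (w : {poly R}) i :
  p \in [pchar R] -> (w^`())`_(i.+1 * p).-1 = 0.
Proof.
move=> pR; have p0 : (0 < p)%N by rewrite prime_gt0 // (pcharf_prime pR).
rewrite coef_deriv prednK ?muln_gt0 // -mulr_natr natrM (pcharf0 pR).
by rewrite !mulr0.
Qed.

(** * The determinant for the exponent p-1 *)

Section Top.
Variables (p : nat) (R : idomainType) (h : {rmorphism 'F_p -> R}).
Hypothesis pp : prime p.

Lemma det_cartier_full r (x : 'I_r -> R) : vandermonde_prod x != 0 ->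
  fpassoc h (\det (cartier_mx p (rootpoly x ^+ p.-1) r)) (vandermonde_prod x ^+ p.-1).
Proof.
move=> D0; have p0 := prime_gt0 pp; have pR := pchar_Fp_morph h pp.
set f := rootpoly x; set D := vandermonde_prod x in D0 *.
pose L : 'M_r := \matrix_(k < r, j < r) (corootpoly x j)`_k.
have detL : fpassoc h (\det L) D.
  (* The quotient f / (X - x_j) vanishes at the other roots, so Vandermonde times [L] is diagonal
     with entries f'(x_i). Its determinant is D^2 up to sign; cancelling one [D] leaves det L. *)
  have e : \matrix_(i < r, k < r) x i ^+ k *m L = diag_mx (\row_i (corootpoly x i).[x i]).
    have -> : \matrix_(i < r, k < r) x i ^+ k = \matrix_(i < r, k < r) ('X^k).[x i].
      by apply/matrixP=> i k; rewrite !mxE hornerXn.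
    rewrite (functional_mx (lam := fun i w => w.[x i])) => [|i a u v|j].
    - apply/matrixP=> i j; rewrite !mxE; have [->|ij] := eqVneq i j; first by rewrite mulr1n.
      by rewrite horner_corootpoly // mulr0n.
    - by rewrite hornerD hornerZ.
    - by rewrite size_corootpoly.
  apply: (fpassocMI D0).
  have [b vb] := det_Vandermonde_tr x; have [c cc] := prod_horner_corootpoly x.
  have : \det L * ((-1) ^+ b * D) = (-1) ^+ c * (D * D).
    rewrite -expr2 -cc -vb mulrC -det_mulmx e det_diag.
    by apply: eq_bigr => i _; rewrite mxE.
  move=> E; apply: fpassoc_trans (fpassoc_sym (fpassoc_sign h b (\det L * D))) _.
  rewrite mulrCA E; exact: fpassoc_sign.
(* With g_j = f / (X - x_j), f^(p-1) g_j = (X - x_j)^(p-1) g_j^p. The first factor is monic of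
   degree p-1, so the coefficients kept are the p-th powers of those of g_j. *)
have N : cartier_mx p (f ^+ p.-1) r *m L = map_mx (pFrobenius_aut pR) L.
  have -> : cartier_mx p (f ^+ p.-1) r =
      \matrix_(i < r, k < r) (f ^+ p.-1 * 'X^k)`_(i.+1 * p).-1.
    by apply/matrixP=> i k; rewrite !mxE mulrC.
  rewrite (functional_mx (lam := fun i w => (f ^+ p.-1 * w)`_(i.+1 * p).-1)) => [|i a u v|j].
  - apply/matrixP=> i j; rewrite !mxE pFrobenius_autE /f (rootpolyD1 x j) exprMn -mulrA.
    rewrite -exprSr prednK // (pchar_polyXE _ pR) coefM_comp_Xp //; last first.
      by rewrite size_exp_XsubC prednK.
    have := lead_coef_exp ('X - (x j)%:P) p.-1; rewrite lead_coefXsubC expr1n.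
    rewrite /lead_coef size_exp_XsubC /= => ->; rewrite mul1r coef_poly size_corootpoly.
    by rewrite ltn_ord.
  - by rewrite mulrDr coefD -scalerAr coefZ.
  - by rewrite size_corootpoly.
apply: (fpassocMI D0); rewrite -exprSr prednK //.
apply: fpassoc_trans (fpassocX p detL).
have <- : \det (cartier_mx p (f ^+ p.-1) r) * \det L = \det L ^+ p.
  by rewrite -det_mulmx N det_map_mx.
by apply: fpassocM; [exact: fpassoc_refl | exact: fpassoc_sym].
Qed.

(** The last row reads the coefficients of index (s+1)(p-1) + (s-j) of a monic polynomial of degree
    (s+1)(p-1), so it is (0, ..., 0, 1). *)
Lemma det_cartier_pred s (x : 'I_s.+1 -> R) :
  \det (cartier_mx p (rootpoly x ^+ p.-1) s.+1) =
  \det (cartier_mx p (rootpoly x ^+ p.-1) s).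
Proof.
have p0 := prime_gt0 pp.
set f := rootpoly x; rewrite (expand_det_row _ ord_max) (bigD1 ord_max) //= big1 => [|j].
  have monf : f ^+ p.-1 \is monic by rewrite monic_exp // rootpoly_monic.
  have := monicP monf; rewrite /lead_coef size_rootpolyX /= => l1.
  rewrite addr0 mxE coefXnM /= ifF; last by apply/negbTE; rewrite -leqNgt mulSn; nia.
  have -> : ((s.+1 * p).-1 - s = s.+1 * p.-1)%N by nia.
  rewrite l1 mul1r /cofactor /= -signr_odd addnn odd_double mul1r; congr (\det _).
  by apply/matrixP=> i j; rewrite !mxE !lift_max.
rewrite -val_eqE /= => js; have := ltn_ord j => js1.
rewrite mxE coefXnM /=; case: ltnP => hh; first by rewrite mul0r.
by rewrite nth_default ?mul0r // size_rootpolyX; nia.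
Qed.

End Top.

(** * Descent on the exponent *)

Section Descent.
Variables (p : nat) (R : idomainType) (h : {rmorphism 'F_p -> R}).
Hypothesis pp : prime p.
Variables (s : nat) (x : 'I_s.+1 -> R) (e : nat).
Let f := rootpoly x.
Let D := vandermonde_prod x.

Definition exact_poly k : {poly R} := f * ('X^k)^`() + (f^`() * 'X^k) *+ e.+1.

Lemma exact_polyE k : f ^+ e * exact_poly k = (f ^+ e.+1 * 'X^k)^`().
Proof.
rewrite /exact_poly derivM [(f ^+ e.+1)^`()]deriv_exp /= mulrDr mulrnAl mulrnAr addrC.
by rewrite exprSr -!mulrA; congr (_ *+ _ + _); rewrite mulrCA.
Qed.

(** Since f is monic of degree s+1, only leading terms reach degree s+k and nothing exceeds it. The
    top coefficients of the family therefore form a triangular matrix. *)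
Lemma coef_exact_poly k l : (k <= l)%N ->
  (exact_poly k)`_(s + l) = (k + s.+1 * e.+1)%:R * (l == k)%:R.
Proof.
move=> kl; have sf : size f = s.+2 by exact: size_rootpoly.
have f1 : f`_s.+1 = 1.
  by have := monicP (rootpoly_monic x); rewrite /lead_coef size_rootpoly.
have f0 m : (s.+1 < m)%N -> f`_m = 0 by move=> hm; rewrite nth_default // sf.
rewrite /exact_poly coefD coefMn derivXn mulrnAr coefMn !coefMXn.
have -> : (s + l < k)%N = false by lia.
rewrite coef_deriv; case: k kl => [|k] kl.
  rewrite mulr0n add0r subn0; have [->|l0] := eqVneq l 0%N.
    by rewrite addn0 f1 mulr1 add0n -mulrnA.
  by rewrite f0 ?mulr0 ?mul0rn //; lia.
have -> : (s + l < k.+1.-1)%N = false by lia.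
have -> : (s + l - k.+1.-1 = (s + (l - k)))%N by lia.
have [->|lk] := eqVneq l k.+1.
  have -> : (s + (k.+1 - k) = s.+1)%N by lia.
  have -> : (s + k.+1 - k.+1 = s)%N by lia.
  by rewrite f1 mulr1 -mulrnA -mulrnDr.
by rewrite !f0 ?mul0rn ?addr0 ?mulr0 //; lia.
Qed.

Lemma size_exact_poly k : (k < s.+1)%N -> (size (exact_poly k) <= s + s.+1)%N.
Proof.
move=> ks; apply/leq_sizeP => m hm.
have -> : m = (s + (m - s))%N by lia.
by rewrite coef_exact_poly; [case: eqP => [|_]; [lia | rewrite mulr0] | lia].
Qed.

(** [det_functional_cross] is applied to X^j, f X^j and [exact_poly k]. The functional [C] kills the
    last family, because f^e turns it into derivatives, and evaluation at the roots kills the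
    second. Up to units the identity reads M0 K D^3 = M1 K D K, where [K] is itself a unit. *)
Lemma det_cartier_step : D != 0 -> (e < p.-1)%N -> (s.+1 * (p.-1 - e) <= p.-1)%N ->
  fpassoc h (\det (cartier_mx p (f ^+ e) s) * D ^+ 2)
            (\det (cartier_mx p (f ^+ e.+1) s)).
Proof.
move=> D0 ep rap; have p0 := prime_gt0 pp; have pR := pchar_Fp_morph h pp.
have sf : size f = s.+2 by exact: size_rootpoly.
have f1 : f`_s.+1 = 1.
  by have := monicP (rootpoly_monic x); rewrite /lead_coef size_rootpoly.
pose C (i : 'I_s) (w : {poly R}) := (f ^+ e * w)`_(i.+1 * p).-1.
pose Z (i : 'I_s.+1) (w : {poly R}) := w`_(s + i).
pose H (i : 'I_s) (w : {poly R}) := w`_(s.+1 + i).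
pose E (i : 'I_s.+1) (w : {poly R}) := w.[x i].
pose q (k : 'I_s.+1) := exact_poly k.
have := @det_functional_cross R s s.+1 C H Z E
  (fun j => 'X^j) (fun j => f * 'X^j) q.
have -> : \matrix_(i, j) C i 'X^j = cartier_mx p (f ^+ e) s.
  by apply/matrixP=> i j; rewrite !mxE /C mulrC.
have -> : \matrix_(i, j) C i (f * 'X^j) = cartier_mx p (f ^+ e.+1) s.
  by apply/matrixP=> i j; rewrite !mxE /C mulrA -exprSr mulrC.
set K := \prod_(k < s.+1) (k + s.+1 * e.+1)%:R : R.
have detZ : \det (\matrix_(i, j) Z i (q j)) = K.
  rewrite -det_tr det_trig => [|]; last first.
    apply/is_trig_mxP => i j ij; rewrite !mxE /Z /q coef_exact_poly; last exact: ltnW.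
    by rewrite gtn_eqF // mulr0.
  by apply: eq_bigr => i _; rewrite !mxE /Z /q coef_exact_poly // eqxx mulr1.
have detH : \det (\matrix_(i, j) H i (f * 'X^j)) = 1.
  rewrite -det_tr det_trig => [|].
    rewrite big1 // => i _; rewrite !mxE /H coefMXn.
    have -> : (s.+1 + i < i)%N = false by lia.
    by rewrite addnK f1.
  apply/is_trig_mxP => i j ij; rewrite !mxE /H coefMXn; case: ltnP => // _.
  by rewrite nth_default // sf; lia.
have [b1 vb] := det_Vandermonde_tr x; have [b2 cc] := prod_horner_corootpoly x.
have [b3 hv] := det_high_eval_mx x.
(* At a root of f, [exact_poly j] takes the value (e+1) f'(x_i) x_i^j: a diagonal matrix times
   Vandermonde. *)
have detE : \det (\matrix_(i, j) E i (q j)) =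
    e.+1%:R ^+ s.+1 * (-1) ^+ b2 * D ^+ 2 * ((-1) ^+ b1 * D).
  have -> : \matrix_(i, j) E i (q j) =
      diag_mx (\row_i (e.+1%:R * (corootpoly x i).[x i])) *m \matrix_(i, k) x i ^+ k.
    apply/matrixP=> i j; rewrite mul_diag_mx !mxE /E /q /exact_poly.
    rewrite hornerD hornerM (horner_rootpoly x i) mul0r add0r hornerMn hornerM hornerXn.
    by rewrite horner_deriv_rootpoly -mulr_natl mulrA.
  rewrite det_mulmx det_diag vb -/D; congr (_ * _).
  under eq_bigr => i _ do rewrite mxE.
  by rewrite big_split /= cc prodr_const card_ord mulrA.
have detA : \det (row_mx (\matrix_(k < s + s.+1, j < s) ('X^j : {poly R})`_k)
                 (\matrix_(k < s + s.+1, j < s.+1) (q j)`_k)) = K.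
  set M := row_mx _ _.
  have -> : M = block_mx 1%:M (\matrix_(k < s, j < s.+1) (q j)`_k) 0
                  (\matrix_(i, j) Z i (q j)).
    apply/matrixP=> i j; rewrite -(splitK i) -(splitK j) /M.
    case: (split i) => a; case: (split j) => c /=.
    - by rewrite row_mxEl block_mxEul !mxE coefXn.
    - by rewrite row_mxEr block_mxEur !mxE.
    - rewrite row_mxEl block_mxEdl !mxE coefXn /=; case: eqP => // ac.
      by have := ltn_ord c; lia.
    - by rewrite row_mxEr block_mxEdr !mxE.
  by rewrite det_ublock det1 mul1r detZ.
rewrite detZ detH detE detA.
have -> : \det (col_mx (\matrix_(i < s, k < s + s.+1) H i 'X^k)
               (\matrix_(i < s.+1, k < s + s.+1) E i 'X^k)) = (-1) ^+ b3 * ((-1) ^+ b1 * D).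
  by rewrite -vb -hv.
(* Modulo p the factor is p + k - (s+1)(p-1-e). It is positive because (s+1)(p-1-e) <= p-1, and
   below p because p-1-e >= 1 and k <= s. *)
have pK k : (k < s.+1)%N -> ~~ (p %| k + s.+1 * e.+1)%N.
  move=> ks; have e1 : (k + s.+1 * e.+1 = s * p + (p + k - s.+1 * (p.-1 - e)))%N by nia.
  have : (0 < p.-1 - e)%N by lia.
  move=> a0; have : (s.+1 <= s.+1 * (p.-1 - e))%N by rewrite leq_pmulr.
  move=> sa; rewrite e1 dvdn_addr ?dvdn_mull // gtnNdvd //; lia.
have K0 : K != 0.
  apply/prodf_neq0 => k _; rewrite -(dvdn_pcharf pR); exact: pK.
move=> /(_ _ _ _ _) cross.
set M0 := \det (cartier_mx p (f ^+ e) s) in cross *.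
set M1 := \det (cartier_mx p (f ^+ e.+1) s) in cross *.
have {}cross : M0 * D ^+ 2 * (e.+1%:R ^+ s.+1 * (-1) ^+ b2) = M1 * (K * (-1) ^+ b3).
  have s0 : (-1) ^+ b1 * D != 0 by rewrite mulf_neq0 // signr_eq0.
  apply: (mulIf s0); apply: (mulIf K0); rewrite [LHS](_ : _ = M0 * K *
    (1 * (e.+1%:R ^+ s.+1 * (-1) ^+ b2 * D ^+ 2 * ((-1) ^+ b1 * D)))); last by ring.
  rewrite cross.
  - ring.
  - split=> i a u v; rewrite /C /H /Z /E.
    + by rewrite mulrDr coefD -scalerAr coefZ.
    + by rewrite coefD coefZ.
    + by rewrite coefD coefZ.
    + by rewrite hornerD hornerZ.
  - split=> j; have js := ltn_ord j.
    + by rewrite size_polyXn; lia.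
    + rewrite (leq_trans (size_polyMleq _ _)) // sf size_polyXn; lia.
    + exact: size_exact_poly.
  - by move=> i j; rewrite /C exact_polyE coef_deriv_pchar.
  - by move=> i j; rewrite /E hornerM (horner_rootpoly x i) mul0r.
have as1 : fpassoc h (e.+1%:R ^+ s.+1 * (-1) ^+ b2) 1.
  rewrite -[X in fpassoc _ _ X](expr1n _ s.+1) -[X in fpassoc _ _ X]mulr1.
  apply: fpassocM.
    apply: fpassocX; rewrite -[X in fpassoc _ X _]mulr1; apply: fpassoc_nat => //.
    by rewrite gtnNdvd //; lia.
  rewrite -[X in fpassoc _ X _]mulr1; exact: fpassoc_sign.
have as2 : fpassoc h (K * (-1) ^+ b3) 1.
  rewrite -[X in fpassoc _ _ X]mulr1; apply: fpassocM.
    rewrite /K; elim/big_rec: _ => [|k y _ IH]; first exact: fpassoc_refl.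
    apply: fpassoc_trans IH; apply: fpassoc_nat => //; exact: pK.
  rewrite -[X in fpassoc _ X _]mulr1; exact: fpassoc_sign.
apply: fpassoc_trans (_ : fpassoc h _ (M0 * D ^+ 2 * (e.+1%:R ^+ s.+1 * (-1) ^+ b2))) _.
  rewrite -[X in fpassoc _ X _]mulr1; apply: fpassocM; first exact: fpassoc_refl.
  exact: fpassoc_sym.
rewrite cross -[X in fpassoc _ _ X]mulr1.
by apply: fpassocM; first exact: fpassoc_refl.
Qed.
End Descent.

(** Induction on a = p-1-e: each step down in the exponent costs a factor D^2. Keeping D^(2a) on the
    left avoids dividing. *)
Lemma det_cartier_descent (p : nat) (R : idomainType) (h : {rmorphism 'F_p -> R})
    s (x : 'I_s.+1 -> R) a :
  prime p -> vandermonde_prod x != 0 -> (a <= p.-1)%N -> (s.+1 * a <= p.-1)%N ->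
  fpassoc h (\det (cartier_mx p (rootpoly x ^+ (p.-1 - a)) s) * vandermonde_prod x ^+ (2 * a))
            (vandermonde_prod x ^+ p.-1).
Proof.
move=> pp D0; elim: a => [|a IH] ap sap.
  rewrite subn0 mulr1 -det_cartier_pred //; exact: det_cartier_full.
have {}IH := IH (ltnW ap) (leq_trans (leq_mul (leqnn _) (leqnSn _)) sap).
apply: fpassoc_trans IH; rewrite mulnS exprD mulrA.
apply: fpassocM; last exact: fpassoc_refl.
have -> : (p.-1 - a = (p.-1 - a.+1).+1)%N by lia.
apply: det_cartier_step => //; first by lia.
by have -> : (p.-1 - (p.-1 - a.+1) = a.+1)%N by lia.
Qed.

(** * Specializations of the generic determinant *)

Lemma map_cartier_mx (R S : nzRingType) (h : {rmorphism R -> S}) p w d :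
  map_mx h (cartier_mx p w d) = cartier_mx p (map_poly h w) d.
Proof.
by apply/matrixP=> i j; rewrite !mxE -[RHS]/(_`_ _) -(map_polyXn h) -rmorphM /= coef_map.
Qed.

Lemma map_rootpoly (R S : nzRingType) (h : {rmorphism R -> S}) r (x : 'I_r -> R) :
  map_poly h (rootpoly x) = rootpoly (fun i => h (x i)).
Proof.
by rewrite rmorph_prod; apply: eq_bigr => i _; rewrite rmorphB /= map_polyX map_polyC.
Qed.

Lemma map_vandermonde_prod (R S : comNzRingType) (h : {rmorphism R -> S}) r (x : 'I_r -> R) :
  h (vandermonde_prod x) = vandermonde_prod (fun i => h (x i)).
Proof.
rewrite rmorph_prod; apply: eq_bigr => i _; rewrite rmorph_prod.
by apply: eq_bigr => j _; rewrite rmorphB.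
Qed.

Lemma vandermonde_prod_neq0 (R : idomainType) r (x : 'I_r -> R) :
  injective x -> vandermonde_prod x != 0.
Proof.
move=> xI; apply/prodf_neq0 => i _; apply/prodf_neq0 => j ij.
by rewrite subr_eq0; apply: contraTneq ij => /xI ->; rewrite ltnn.
Qed.

Lemma mpolyX_inj (R : nzRingType) n : injective (fun i : 'I_n => 'X_i : {mpoly R[n]}).
Proof.
move=> i j /= /(congr1 (fun q : {mpoly R[n]} => q@_(U_(i)%MM))).
rewrite !mcoeffX eqxx; case: eqP => [/eqP|_ /eqP]; last by rewrite oner_eq0.
by move/eqP/(congr1 (fun m : 'X_{1..n} => m i)); rewrite !mnm1E eqxx; case: eqP.
Qed.

Definition generic_det (p r e d g : nat) :=
  fpassoc (@mpolyC r 'F_p)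
    (\det (cartier_mx p (rootpoly (fun i : 'I_r => 'X_i : {mpoly 'F_p[r]}) ^+ e) d))
    (vandermonde_prod (fun i : 'I_r => 'X_i : {mpoly 'F_p[r]}) ^+ g).

Section Specialization.
Variables (p r e d g : nat).
Hypothesis pp : prime p.
Hypothesis generic : generic_det p r e d g.

Lemma det_cartier_special (S : idomainType) (h : {rmorphism 'F_p -> S}) (x : 'I_r -> S) :
  fpassoc h (\det (cartier_mx p (rootpoly x ^+ e) d)) (vandermonde_prod x ^+ g).
Proof.
have [c c0 /(congr1 (mmap h x))] := generic.
rewrite -det_map_mx map_cartier_mx rmorphXn /= map_rootpoly rmorphM rmorphXn /=.
rewrite map_vandermonde_prod [mmap _ _ c%:MP]mmapC => E.
have Xx i : mmap h x 'X_i = x i by rewrite mmapX mmap1U.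
exists c => //; rewrite (_ : rootpoly x = rootpoly (fun i => mmap h x 'X_i)) ?E.
  congr (_ * _ ^+ _); apply: eq_bigr => i _; apply: eq_bigr => j _; by rewrite /= !Xx.
by apply: eq_bigr => i _; rewrite /= Xx.
Qed.

Lemma special_det_neq0 (S : idomainType) (h : {rmorphism 'F_p -> S}) (x : 'I_r -> S) :
  injective x -> \det (cartier_mx p (rootpoly x ^+ e) d) != 0.
Proof.
move=> xI; apply: (fpassoc_neq0 (fpassoc_sym (det_cartier_special h x))).
by rewrite expf_neq0 // vandermonde_prod_neq0.
Qed.

(** Put x_0 = 0 and keep the other roots generic: X^e divides f^e, so for e >= p the first row,
    which reads indices at most p-1, vanishes although the roots are distinct. *)
Lemma generic_exp_lt : (0 < r)%N -> (0 < d)%N -> (e < p)%N.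
Proof.
case: r generic det_cartier_special special_det_neq0 => // n _ _ nz _ d0.
rewrite ltnNge; apply/negP => pe.
pose x (i : 'I_n.+1) : {mpoly 'F_p[n.+1]} := if i == ord0 then 0 else 'X_i.
have Xn0 (i : 'I_n.+1) : ('X_i : {mpoly 'F_p[n.+1]}) != 0.
  apply/eqP => /(congr1 (fun q : {mpoly 'F_p[n.+1]} => q@_(U_(i)%MM))).
  by rewrite mcoeffX mcoeff0 eqxx => /eqP; rewrite oner_eq0.
have xI : injective x.
  move=> i j; rewrite /x; case: eqP => [->|_]; case: eqP => [->|_] // /eqP.
  - by rewrite eq_sym (negPf (Xn0 _)).
  - by rewrite (negPf (Xn0 _)).
  - by move/eqP/mpolyX_inj.
have /negP[] := nz _ (@mpolyC n.+1 'F_p) x xI; apply/eqP.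
rewrite (expand_det_row _ (Ordinal d0)) big1 // => j _.
rewrite mxE mul1n coefXnM; case: ltnP => [_|hj]; first by rewrite mul0r.
rewrite (rootpolyD1 x ord0) {1}/x eqxx subr0 exprMn coefXnM.
by case: ltnP => [|le]; [rewrite mul0r | have := prime_gt0 pp; lia].
Qed.

(** The last row reads indices at least d(p-1); beyond the degree re of f^e it would vanish. *)
Lemma generic_mul_le : (0 < d)%N -> (d * p.-1 <= r * e)%N.
Proof.
move=> d0; rewrite leqNgt; apply/negP => lt.
have d1 : (d.-1 < d)%N by rewrite prednK.
have /negP[] := special_det_neq0 (@mpolyC r 'F_p) (@mpolyX_inj _ r); apply/eqP.
rewrite (expand_det_row _ (Ordinal d1)) big1 // => j _.
rewrite mxE coefXnM /= (prednK d0); case: ltnP => h; first by rewrite mul0r.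
have jd := ltn_ord j; have p0 := prime_gt0 pp.
by rewrite nth_default ?mul0r // size_rootpolyX; nia.
Qed.

Lemma coef_comp_scaleX (S : comNzRingType) (c : S) (q : {poly S}) k :
  (q \Po (c *: 'X))`_k = c ^+ k * q`_k.
Proof.
rewrite comp_polyE.
have -> : \sum_(i < size q) q`_i *: (c *: 'X) ^+ i = \poly_(i < size q) (c ^+ i * q`_i).
  by rewrite poly_def; apply: eq_bigr => i _; rewrite exprZn scalerA mulrC.
by rewrite coef_poly; case: ltnP => // h; rewrite nth_default // mulr0.
Qed.

(** Homogeneity: scale every x_i by a new variable T and compare the powers of T in the determinant
    and in delta^g. The equation is doubled to clear the binomial coefficients. *)
Lemma generic_degree :
  (g * (r * r.-1) + p.-1 * (d * d.+1) = 2 * (d * (r * e)))%N.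
Proof.
pose S := {mpoly 'F_p[r]}; pose y (i : 'I_r) : S := 'X_i.
pose h := (@mpolyC r 'F_p : {rmorphism 'F_p -> S}).
pose h' := (polyC \o h : {rmorphism 'F_p -> {poly S}}).
pose x (i : 'I_r) : {poly S} := (y i) *: 'X.
have p0 := prime_gt0 pp.
pose w' := rootpoly x ^+ e; pose w := rootpoly y ^+ e.
(* The scaled polynomial at TX is T^(re) times the original at X; thus coefficient k acquires
   T^(re-k), written without subtraction. *)
have cw k : 'X^k * w'`_k = 'X^(r * e) * (w`_k)%:P.
  rewrite -coef_comp_scaleX /w' rmorphXn /= rmorph_prod /=.
  have -> : \prod_i (('X - (x i)%:P) \Po ('X *: 'X)) = 'X^r *: map_poly polyC (rootpoly y).
    rewrite map_rootpoly -[X in 'X^X](card_ord r) -prodr_const -scaler_prod.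
    apply: eq_bigr => i _; rewrite raddfB /= comp_polyX comp_polyC scalerBr.
    by rewrite -[X in _ = _ - X]mul_polyC -polyCM mulrC mul_polyC.
  by rewrite exprZn coefZ -exprM -rmorphXn /= coef_map.
pose a := (\sum_(i < d) (i.+1 * p).-1)%N; pose b := (\sum_(j < d) (r * e + j))%N.
(* Multiplying row i by T^((i+1)p-1) amounts to multiplying column j of the unscaled matrix by
   T^(re+j). *)
have detE : 'X^a * \det (cartier_mx p w' d) = 'X^b * (\det (cartier_mx p w d))%:P.
  have dg (u : 'I_d -> nat) : \det (diag_mx (\row_i ('X^(u i) : {poly S}))) = 'X^(\sum_i u i).
    by rewrite det_diag -prodrXr; apply: eq_bigr => i _; rewrite mxE.
  rewrite /a /b -!dg -det_mulmx -det_map_mx mulrC -det_mulmx; congr (\det _).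
  apply/matrixP=> i j; rewrite mul_diag_mx mul_mx_diag !mxE !coefXnM.
  case: ltnP => hj; first by rewrite rmorph0 mulr0 mul0r.
  rewrite -{1}(subnK hj) exprD -mulrA [_ * w'`__]mulrC mulrA cw exprD /=.
  by rewrite [RHS]mulrC -!mulrA; congr (_ * _); rewrite mulrC.
have vE : vandermonde_prod x = 'X^('C(r, 2)) * (vandermonde_prod y)%:P.
  have -> : 'C(r, 2) = (\sum_(i < r) \sum_(j < r | (i < j)%N) 1)%N.
    rewrite -triangular_sum big_mkord (exchange_big_dep predT) //=.
    apply: eq_bigr => j _; rewrite sum1_card.
    have wI : injective (widen_ord (ltnW (ltn_ord j))).
      by move=> k l /(congr1 val) /= /val_inj.
    rewrite -[LHS]card_ord -(card_imset _ wI).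
    apply: eq_card => k; apply/imsetP/idP => [[l _ ->]|kj].
      exact: (ltn_ord l).
    by exists (Ordinal (kj : (k < j)%N)) => //; apply: val_inj.
  rewrite (map_vandermonde_prod polyC) -prodrXr -big_split /=.
  apply: eq_bigr => i _; rewrite -prodrXr -big_split /=; apply: eq_bigr => j _.
  by rewrite /x -!mul_polyC -mulrBl expr1 mulrC.
have [c c0 E1] := det_cartier_special h' x.
have [c' c'0 E2] := det_cartier_special h y.
have : (h c * vandermonde_prod y ^+ g)%:P * 'X^(a + 'C(r, 2) * g) =
    (h c' * vandermonde_prod y ^+ g)%:P * 'X^b.
  move: detE; rewrite E1 E2 vE exprMn -exprM -rmorphXn [RHS]mulrC => <-.
  rewrite exprD polyCM /h' /=; ring.
move/(congr1 (fun q : {poly S} => size q)).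
have V0 : vandermonde_prod y ^+ g != 0.
  by rewrite expf_neq0 // vandermonde_prod_neq0 //; exact: mpolyX_inj.
have nz u : u != 0 -> h u * vandermonde_prod y ^+ g != 0.
  by move=> u0; rewrite mulf_neq0 // fmorph_eq0.
rewrite !size_Cmul ?nz // !size_polyXn => -[].
have aE : (2 * a + 2 * d = p * (d * d.+1))%N.
  rewrite /a; elim: (d) => [|n IH]; first by rewrite big_ord0 mul0n !muln0.
  rewrite big_ord_recr /=; have : ((n.+1 * p).-1.+1 = n.+1 * p)%N by rewrite prednK ?muln_gt0.
  move: IH; move: (\sum_(i < n) _)%N ((n.+1 * p).-1)%N => A B; clear. nia.
have bE : (2 * b + d = 2 * (d * (r * e)) + d * d)%N.
  rewrite /b; elim: (d) => [|n IH]; first by rewrite big_ord0.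
  rewrite big_ord_recr /=; move: IH; move: (\sum_(i < n) _)%N => B; clear; nia.
have := mul_bin_diag r 1; have := bin1 r.-1; have := p0; nia.
Qed.

End Specialization.

(** * The degree in one root *)

Lemma size_coef_mul_XsubX (S : comNzRingType) (q : {poly S}) e k :
  (size ((('X - ('X)%:P) ^+ e * map_poly polyC q : {poly {poly S}})`_k)%R <= e.+1)%N.
Proof.
elim: e k => [|e IH] k.
  by rewrite mul1r coef_map /= size_polyC_leq1.
rewrite exprS -mulrA mulrBl coefB coefXM coefCM.
rewrite (leq_trans (size_polyD _ _)) // geq_max size_polyN; apply/andP; split.
  by case: k => [|k] /=; rewrite ?size_poly0 // ltnW // ltnS.
by rewrite (leq_trans (size_polyMleq _ _)) // size_polyX add2n /= ltnS.
Qed.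

Lemma size_det_leq (S : idomainType) d (M : 'M[{poly S}]_d) e :
  (forall i j, (size (M i j) <= e.+1)%N) -> (size (\det M) <= (d * e).+1)%N.
Proof.
move=> sM; rewrite (leq_trans (size_sum _ _ _)) //; apply/bigmax_leqP => s _.
rewrite -[(-1) ^+ s]/((-1) ^+ (s : bool)) mulr_sign.
have sP : (size (\prod_i M i (s i))%R <= (d * e).+1)%N.
  rewrite (leq_trans (size_poly_prod_leq _ _)) // leq_subLR.
  rewrite card_ord addnS ltnS -mulnS -[X in (_ <= X * _)%N](card_ord d) -sum_nat_const.
  by apply: leq_sum => i _.
by case: (s : bool); rewrite ?size_polyN.
Qed.

(** Regard x_0 as the polynomial variable: every entry has degree at most e in it, so the
    determinant has degree at most de, whereas delta^g has degree g(r-1). *)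
Lemma generic_top_degree (p r e d g : nat) :
  generic_det p r e d g ->
  (g * r.-1 <= d * e)%N.
Proof.
case: r => [|n] gen; first by rewrite muln0.
pose S := {mpoly 'F_p[n.+1]}; pose y (i : 'I_n.+1) : S := 'X_i.
pose h := (polyC \o @mpolyC n.+1 'F_p : {rmorphism 'F_p -> {poly S}}).
pose x (i : 'I_n.+1) : {poly S} := if i == ord0 then 'X else (y i)%:P.
have [c c0 E] := det_cartier_special gen h x.
have xn i : i != ord0 -> x i = (y i)%:P by move=> /negPf i0; rewrite /x i0.
have x0 : x ord0 = 'X by rewrite /x eqxx.
have szV : size (vandermonde_prod x ^+ g) = (g * n).+1.
  pose v := \prod_(i < n) \prod_(j < n.+1 | (lift ord0 i < j)%N) (y (lift ord0 i) - y j).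
  have v0 : v != 0.
    apply/prodf_neq0 => i _; apply/prodf_neq0 => j ij; rewrite subr_eq0.
    by apply: contraTneq ij => /mpolyX_inj <-; rewrite ltnn.
  have -> : vandermonde_prod x = v%:P * corootpoly y ord0.
    rewrite /vandermonde_prod big_ord_recl mulrC; congr (_ * _).
      rewrite rmorph_prod; apply: eq_bigr => i _; rewrite rmorph_prod; apply: eq_bigr => j ij.
      have j0 : j != ord0 by apply: contraTneq ij => ->; rewrite ltn0.
      by rewrite !xn ?rmorphB // eq_sym neq_lift.
    apply: eq_big => [[[|j] hj]|j j0] //.
    by rewrite x0 xn //; apply: contraTneq j0 => ->.
  rewrite exprMn -rmorphXn /= size_Cmul ?expf_neq0 //.
  have U0 : corootpoly y ord0 ^+ g != 0.
    by rewrite expf_neq0 // -size_poly_gt0 size_corootpoly.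
  by rewrite -(prednK (n := size _)) ?size_poly_gt0 // size_exp size_corootpoly mulnC.
have := @size_det_leq S d (cartier_mx p (rootpoly x ^+ e) d) e.
rewrite E size_Cmul ?fmorph_eq0 // szV ltnS; apply => i j.
rewrite mxE coefXnM; case: ifP => _; first by rewrite size_poly0.
rewrite (rootpolyD1 x ord0) exprMn /x eqxx.
have -> : corootpoly x ord0 = map_poly polyC (corootpoly y ord0).
  rewrite rmorph_prod; apply: eq_bigr => k k0.
  by rewrite xn ?rmorphB /= ?map_polyX ?map_polyC // eq_sym.
by rewrite -rmorphXn /=; apply: size_coef_mul_XsubX.
Qed.

(** * Specialization to roots of unity *)

Lemma roots_of_unity (p r : nat) : prime p -> ~~ (p %| r)%N ->
  exists (L : fieldType) (h : {rmorphism 'F_p -> L}) (x : 'I_r -> L),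
    injective x /\ rootpoly x = 'X^r - 1.
Proof.
move=> pp pr; have r0 : (0 < r)%N by case: r pr => //; rewrite dvdn0.
have q0 : ('X^r - 1 : {poly 'F_p}) != 0.
  by rewrite monic_neq0 // monicXnsubC.
have [L [rs eqrs _]] := FinSplittingFieldFor q0.
have pL : p \in [pchar L] by rewrite pchar_lalg pchar_Fp.
rewrite rmorphB rmorph1 /= map_polyXn in eqrs.
have {}eqrs : 'X^r - 1 = \prod_(z <- rs) ('X - z%:P).
  by apply/eqP; rewrite -eqp_monic ?monicXnsubC ?monic_prod_XsubC.
have szr : size rs = r.
  have := congr1 (fun q : {poly L} => size q) eqrs.
  by rewrite size_XnsubC // size_prod_XsubC => -[].
have urs : uniq rs.
  rewrite -separable_prod_XsubC -eqrs.
  by rewrite cyclotomic.separable_Xn_sub_1 // -(dvdn_pcharf pL).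
exists L, (in_alg L), (fun i : 'I_r => rs`_i); split.
  by move=> i j /eqP; rewrite nth_uniq ?szr // => /eqP/val_inj.
by rewrite eqrs (big_nth 0) szr big_mkord.
Qed.

(* With m = p mod r in {2..d}, the images d+1-m and d+2-m are both sent outside
   {1..d} by adding m, whereas only the image of d can be. *)
Lemma mod_interval_perm (p r d : nat) (s : {perm 'I_d}) :
  (0 < d)%N -> (d.+2 <= r)%N ->
  (forall i : 'I_d, (i.+1 * p = (s i).+1 %[mod r])%N) -> (r %| p.-1)%N.
Proof.
move=> d0 dr sE; pose i0 := Ordinal d0; pose m := (s i0).+1.
have pm : (p = m %[mod r])%N by rewrite -[p]mul1n (sE i0).
have [m1|m2] := leqP m 1.
  have {}m1 : m = 1%N by rewrite /m in m1 *; lia.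
  have [->|p0] := posnP p; first by rewrite dvdn0.
  move/eqP: pm; rewrite m1 eqn_mod_dvd // subn1 //.
have md : (m <= d)%N by exact: ltn_ord.
(* Otherwise index i+1 has an image z with z+1 congruent to y+m+1 modulo r; but z+1 lies in 1..d and
   y+m+1 is d+1 or d+2, so their difference is between 1 and d+1 < r. *)
have last y (i : 'I_d) : s i = y :> nat ->
    (d <= y + m)%N -> (y + m <= d.+1)%N -> i = d.-1 :> nat.
  move=> siy h1 h2; have id := ltn_ord i.
  have [i1d|] := ltnP i.+1 d; last by lia.
  have := sE (Ordinal i1d); set z := s _ => /=; have zd := ltn_ord z => E.
  have : ((y + m).+1 = z.+1 %[mod r])%N.
    by rewrite -E mulSn -modnDm pm (sE i) modnDm siy; congr (_ %% _)%N; lia.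
  move/eqP; rewrite eqn_mod_dvd; last by clear -h1 zd; lia.
  by rewrite gtnNdvd //; clear -h1 h2 zd d0 dr; lia.
have h1 : (d - m < d)%N by lia.
have h2 : ((d - m).+1 < d)%N by lia.
have l1 : (s^-1%g (Ordinal h1)) = d.-1 :> nat.
  by apply: (last (d - m)%N); rewrite ?permKV //=; lia.
have l2 : (s^-1%g (Ordinal h2)) = d.-1 :> nat.
  by apply: (last (d - m).+1); rewrite ?permKV //=; lia.
have : s^-1%g (Ordinal h1) = s^-1%g (Ordinal h2) by apply: val_inj; rewrite /= l1 l2.
by move/perm_inj/(congr1 val) => /=; lia.
Qed.

(** At the r-th roots of unity f^e = (X^r - 1)^e only has exponents divisible by r. A nonzero term
    of the Leibniz expansion is then a permutation as in [mod_interval_perm]. *)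
Lemma generic_dvd (p r e d g : nat) : prime p ->
  generic_det p r e d g ->
  ~~ (p %| r)%N -> (0 < d)%N -> (d.+2 <= r)%N -> (r %| p.-1)%N.
Proof.
move=> pp gen pr d0 dr; have [L [h [x [xI xE]]]] := roots_of_unity pp pr.
have r0 : (0 < r)%N by lia.
have := special_det_neq0 gen h xI; rewrite xE => nz.
have coef0 k : (('X^r - 1 : {poly L}) ^+ e)`_k != 0 -> (r %| k)%N.
  have -> : 'X^r - 1 = ('X - 1) \Po 'X^r :> {poly L}.
    by rewrite raddfB /= comp_polyX -[1]/(1%:P) comp_polyC.
  rewrite -rmorphXn /= coef_comp_poly_Xn //; case: ifP => //; by rewrite eqxx.
have [s /forallP sP] : exists s : {perm 'I_d}, [forall i,
    cartier_mx p (('X^r - 1 : {poly L}) ^+ e) d i (s i) != 0].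
  apply/existsP; apply: contraR nz; rewrite negb_exists => /forallP ns.
  apply/eqP; apply: big1 => s _; have := ns s; rewrite negb_forall => /existsP[i].
  by rewrite negbK => /eqP M0; rewrite (bigD1 i) //= M0 mul0r mulr0.
apply: (mod_interval_perm d0 dr (s := s)) => i.
have := sP i; rewrite mxE coefXnM; case: ltnP => [|sip]; first by rewrite eqxx.
move/coef0; have := prime_gt0 pp => p0 hd.
have ip : (0 < i.+1 * p)%N by rewrite muln_gt0.
apply/eqP; rewrite eqn_mod_dvd; last by lia.
by have -> : (i.+1 * p - (s i).+1 = (i.+1 * p).-1 - s i)%N by lia.
Qed.

(** * Excluding d <= r-2 when p divides r *)

Lemma degree_contradiction_pos k e g : (1 < k)%N -> (0 < e)%N -> (0 < g)%N ->
  (g * (k * k * e + k.-1))%N <> (k * e ^ 2)%N.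
Proof.
case: k => [|[|k]] // _ e0 g0 /= E.
(* Write n = k+2. Then n is coprime to n^2 e + n - 1 and divides the right-hand side, hence g. *)
have kg : (k.+2 %| g)%N.
  have cop : coprime k.+2 (k.+2 * k.+2 * e + k.+1).
    by rewrite -mulnA [(k.+2 * _)%N]mulnC /coprime gcdnMDl -/(coprime _ _) coprimeSn.
  by rewrite -(Gauss_dvdl _ cop) E dvdn_mulr.
case/dvdnP: kg g0 E => c -> c0 E.
have {c0} c0 : (0 < c)%N by case: c c0 E.
have {}E : (c * (k.+2 * k.+2 * e + k.+1) = e * e)%N.
  by apply/eqP; rewrite -(eqn_pmul2l (ltn0Sn k.+1)); apply/eqP; lia.
have le1 : (c * (k.+2 * k.+2) <= e)%N.
  by rewrite -(leq_pmul2r e0) -E; lia.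
(* From e (e - c n^2) = c (n-1) > 0 the factor e - c n^2 is at least 1, so e <= c (n-1), against c
   n^2 <= e. *)
have le2 : (e <= c * k.+1)%N.
  rewrite leqNgt; apply/negP => lt.
  have [eqe|lte] := eqVneq (c * (k.+2 * k.+2))%N e; first by nia.
  have {le1 lte} le1 : (c * (k.+2 * k.+2) < e)%N by rewrite ltn_neqAle lte.
  by have : ((c * (k.+2 * k.+2)).+1 * e <= e * e)%N; [rewrite leq_mul2r le1 orbT | nia].
have : (c * (k.+2 * k.+2) <= c * k.+1)%N by exact: leq_trans le1 le2.
by rewrite leq_pmul2l //; lia.
Qed.

(** Here r = kp. Reducing the homogeneity relation modulo p gives p | d(d+1), so d is p or p-1. The
    bounds d(p-1) <= re <= (d+1)(p-1) then force ke = p-1, and for either d the relation becomes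
    g(kp-1) = k e^2. *)
Lemma degree_contradiction (k p e d g : nat) : prime p ->
  (d <= p)%N -> (0 < d)%N -> (d.+2 <= k * p)%N -> (0 < g)%N ->
  (d * p.-1 <= k * p * e)%N ->
  (g * (k * p * (k * p).-1) + p.-1 * (d * d.+1) = 2 * (d * (k * p * e)))%N ->
  (g * (k * p).-1 <= d * e)%N -> False.
Proof.
move=> pp dp d0 dr g0 lo deg top; have p1 := prime_gt1 pp.
have hi : (k * p * e <= p.-1 * d.+1)%N.
  have t : (g * (k * p * (k * p).-1) <= d * (k * p * e))%N.
    by rewrite mulnCA [(d * _)%N]mulnCA leq_mul2l top orbT.
  rewrite -(leq_pmul2l d0); move: deg t; rewrite mulnCA [(d * (p.-1 * _))%N]mulnCA.
  by move: (g * _)%N (d * (k * p * e))%N (_ * (d * d.+1))%N => A B C; clear; lia.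
have pd : (p %| d)%N || (p %| d.+1)%N.
  rewrite -Euclid_dvdM // -(@Gauss_dvdr _ p.-1); last first.
    by rewrite coprime_sym coprimePn ?(ltnW p1).
  have pkp : (p %| k * p)%N by rewrite dvdn_mull.
  have pr : (p %| 2 * (d * (k * p * e)))%N.
    by apply: dvdn_mull; apply: dvdn_mull; apply: dvdn_mulr.
  have pl : (p %| g * (k * p * (k * p).-1))%N by apply: dvdn_mull; apply: dvdn_mulr.
  by rewrite -(dvdn_addr _ pl) deg.
have [q pE] : exists q, p = q.+1 by exists p.-1; rewrite prednK // ltnW.
have dE : d = p \/ d = q.
  by case/orP: pd => /dvdn_leq; clear -dp d0 pE; lia.
have k1 : (1 < k)%N.
  case: k {lo deg top hi} dr => [|[|k]] //; rewrite mul1n.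
  by clear -dE pE; lia.
have ke : (k * e = q)%N.
  move: lo hi; rewrite [(k * p)%N]mulnC -mulnA; move: (k * e)%N => t.
  by case: dE => ->; rewrite pE /=; clear; nia.
have q0 : (0 < q)%N by rewrite -ltnS -pE.
have e0 : (0 < e)%N by case: (e) ke q0 => // <-; rewrite muln0.
apply: (@degree_contradiction_pos k e g k1 e0 g0).
have -> : (k * k * e + k.-1 = (k * p).-1)%N.
  by rewrite pE -ke mulnS mulnA; move: (k * k * e)%N => t; clear -k1; lia.
have kp : (0 < k * p)%N by rewrite muln_gt0 (ltnW k1) ltnW.
apply/eqP; rewrite -(eqn_pmul2r kp); apply/eqP.
have -> : (k * e ^ 2 * (k * p) = q * q * p)%N by rewrite -ke; clear; lia.
have -> : (g * (k * p).-1 * (k * p) = g * (k * p * (k * p).-1))%N.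
  by rewrite -mulnA [((k * p).-1 * _)%N]mulnC.
move: deg; rewrite [(k * p * e)%N]mulnAC ke; move: (g * _)%N => A.
by case: dE => ->; rewrite pE /=; clear; nia.
Qed.

(** * The two inclusions *)

Lemma inA_fpassoc (p r e d : nat) : (d <= p)%N ->
  (exists (eps : 'F_p) (g : nat), [/\ eps != 0, (0 < g)%N &
      \det (Mmat p r e d) = eps%:MP * vdelta p r ^+ g]) <->
  exists2 g, (0 < g)%N & generic_det p r e d g.
Proof.
move=> dp; have [b ->] := Mmat_cartier r e dp; set M := \det _.
have sM := fpassoc_sign (@mpolyC r 'F_p) b M.
split=> [[eps [g [e0 g0 E]]]|[g g0 E]].
  exists g => //; apply: fpassoc_trans (fpassoc_sym sM) _; by exists eps.
by have [eps e0 ->] := fpassoc_trans sM E; exists eps, g.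
Qed.

Theorem theorem2 (p : nat) : prime p ->
  forall r e d : nat,
    (inA p r e d /\ (r = 2%N \/ ~~ (r %| p.-1)%N)) <->
    (inB p r e d /\ (r = 2%N \/ ~~ (r %| p.-1)%N)).
Proof.
move=> pp r e d; have p1 := prime_gt1 pp.
split=> [[] [r2 e0 /andP[d0 dp] /(inA_fpassoc r e dp)[g g0 gen]] hr|[]].
- split=> //.
  have r0 : (0 < r)%N by exact: ltnW.
  have ep := generic_exp_lt pp gen r0 d0.
  have lo := generic_mul_le pp gen d0.
  have deg := generic_degree pp gen.
  have q0 : (0 < p.-1)%N by clear -p1; lia.
  have eq : (e <= p.-1)%N by clear -ep; lia.
  have dr : (d <= r)%N.
    by rewrite -(leq_pmul2r q0) (leq_trans lo) // leq_mul2l eq orbT.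
  (* Here r = 2 would give d = 0, so r does not divide p-1; both p | r and its negation are then
     contradictory. *)
  have [dr2|dr2] := leqP d.+2 r.
    have rp : ~~ (r %| p.-1)%N.
      by case: hr => // r_eq; clear -dr2 r_eq d0; lia.
    have [/dvdnP[k rE]|pr] := boolP (p %| r)%N.
      have top := generic_top_degree gen.
      rewrite rE in dr2 lo deg top.
      by have := degree_contradiction pp dp d0 dr2 g0 lo deg top.
    by rewrite (generic_dvd pp gen pr d0 dr2) in rp.
  have [drE|drE] : d = r \/ d = r.-1 by clear -dr dr2; lia.
    left; split=> //; first by rewrite r2 -drE.
    (* For d = r the bound d(p-1) <= re gives e >= p-1. *)
    by apply/eqP; rewrite eqn_leq eq -(leq_pmul2l r0) -{1}drE.
  have rE : r = r.-1.+1 by rewrite prednK.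
  have r1 : (0 < r * r.-1)%N by rewrite muln_gt0 r0; clear -r2; lia.
  (* For d = r-1 the homogeneity relation is divisible by r(r-1). The value g = 2e - (p-1) > 0
     yields the lower bound on e required in B_0. *)
  have gE : (g + p.-1 = 2 * e)%N.
    apply/eqP; rewrite -(eqn_pmul2r r1); apply/eqP.
    move: deg; rewrite drE (prednK r0).
    by move: (r.-1) (p.-1) => u v; clear; lia.
  right; left; split=> //.
  + by rewrite r2 rE -drE ltnS.
  + by rewrite -gE -{1}[p.-1]add0n ltn_add2r.
  + by rewrite mulnBr leq_subLR {1}rE mulSn addnC leq_add2r -drE.
case=> [[/andP[r2 rp] -> ->] hr|[]].
- split=> //; split=> //; [by clear -p1; lia | by rewrite rp ltnW |].
  apply/(inA_fpassoc _ _ rp); exists p.-1; first by clear -p1; lia.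
  by apply: det_cartier_full => //; apply/vandermonde_prod_neq0/mpolyX_inj.
- move=> [/andP[r2 rp] e1 ep rap ->] hr; split=> //.
  have dp : (r.-1 <= p)%N by clear -rp; lia.
  split=> //; [by clear -e1 p1; lia | by rewrite dp andbT; clear -r2; lia |].
  (* The descent from p-1 to e has p-1-e steps, each costing delta^2; the remaining exponent 2e -
     (p-1) is positive. *)
  apply/(inA_fpassoc _ _ dp); exists (p.-1 - 2 * (p.-1 - e))%N; first by clear -e1 ep; lia.
  case: r r2 {rp hr dp} rap => // s _ rap /=.
  have V0 : vandermonde_prod (fun i : 'I_s.+1 => 'X_i : {mpoly 'F_p[s.+1]}) != 0.
    by apply/vandermonde_prod_neq0/mpolyX_inj.
  apply: (fpassocMI (expf_neq0 (2 * (p.-1 - e)) V0)).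
  rewrite -exprD subnK; last by clear -e1 ep; lia.
  rewrite -{1}(subKn ep).
  by apply: det_cartier_descent => //; exact: leq_subr.
(* In B_- the equation makes r divide p-1, and r = 2 would give 2e = p-1, against (p-1)/2 < e. *)
move=> [r2 e1 ep rap _] [r_eq|/negP[]]; first by clear -r_eq rap e1 ep; subst; lia.
by apply/dvdnP; exists (p.-1 - e)%N; rewrite mulnC rap.
Qed.
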